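(* Fix an integer $k\ge 2$. There exists a triple $(M,\pi_0,\mathcal L)$, where (1) $M=(S,A,T,R,\gamma)$ is an MDP with $|S|=2$ and $|A|=k$, (2) $\pi_0:S\to A$ is a policy for $M$, and (3) $\mathcal L$ is a policy iteration (PI) algorithm that performs max-gain action selection, such that if $\mathcal L$ is initialised at $\pi_0$ and executed on $M$, it visits at least $2k-1$ policies for $M$.
   Context: A (finite, discounted) MDP is a tuple $(S,A,T,R,\gamma)$ with finite state set $S$; finite action set $A$ (all actions available at every state); transition function $T:S\times A\times S\to[0,1]$ with $\sum_{s'}T(s,a,s')=1$; reward function $R:S\times A\to\mathbb R$; and discount factor $\gamma\in[0,1)$. A policy is a map $\pi:S\to A$. Its value function $V^\pi:S\to\mathbb R$ is the unique solution of $V^\pi(s)=R(s,\pi(s))+\gamma\sum_{s'}T(s,\pi(s),s')V^\pi(s')$. The action value function is $Q^\pi(s,a)=R(s,a)+\gamma\sum_{s'}T(s,a,s')V^\pi(s')$ and the gain is $\rho^\pi(s,a)=Q^\pi(s,a)-V^\pi(s)$. The improvable set is $I^\pi=\{(s,a):\rho^\pi(s,a)>0\}$. A valid improvement set is a nonempty $I\subseteq I^\pi$ containing at most one pair $(s,a)$ for each $s\in S$. A policy improvement step from $\pi$ using $I$ yields the policy $\pi'$ with $\pi'(s)=a$ if $(s,a)\in I$ and $\pi'(s)=\pi(s)$ otherwise. The step uses max-gain action selection if for each $(s,a)\in I$, the action $a$ maximises $\rho^\pi(s,\cdot)$ over all actions (ties broken arbitrarily); the set of states at which switches are made is unrestricted.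 A PI algorithm with max-gain action selection, started at a policy $\pi_0$, produces a sequence $\pi_0,\pi_1,\dots,\pi_\ell$, each $\pi_{i+1}$ being obtained from $\pi_i$ by a policy improvement step with max-gain action selection, and stops when $I^{\pi_\ell}=\emptyset$. The policies visited are $\pi_0,\dots,\pi_\ell$. *)

(* Defs.v *)
From mathcomp Require Import all_boot all_order all_algebra.
From mathcomp Require Import boolp classical_sets reals.

Set Implicit Arguments.
Unset Strict Implicit.
Unset Printing Implicit Defensive.

Import Order.TTheory GRing.Theory Num.Theory.

Local Open Scope ring_scope.

Record mdp (R : realType) := MDP {
  state : finType;
  action : finType;
  trans : state -> action -> state -> R;
  reward : state -> action -> R;
  discount : R;
  trans_itv : forall s a s', 0 <= trans s a s' <= 1;
  trans_sum : forall s a, \sum_(s' : state) trans s a s' = 1;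
  discount_itv : 0 <= discount < 1
}.

Arguments MDP {R} state action trans reward discount.

Definition policy (R : realType) (M : mdp R) : Type :=
  {ffun state M -> action M}.

Section Values.
Variables (R : realType) (M : mdp R) (pi : policy M).

Definition bellman (V : {ffun state M -> R}) : Prop :=
  forall s, V s = reward s (pi s)
                  + discount M * \sum_(s' : state M) trans s (pi s) s' * V s'.

(* [xget] picks a solution of the Bellman equations; there is exactly one, by
   [value_bellman] and [bellman_unique] below, so the default is never used. *)
Definition value : {ffun state M -> R} := xget [ffun=> 0] [set V | bellman V].

Definition qvalue (s : state M) (a : action M) : R :=
  reward s a + discount M * \sum_(s' : state M) trans s a s' * value s'.

Definition gain (s : state M) (a : action M) : R := qvalue s a - value s.

Definition improvable : {set state M * action M} :=
  [set sa | 0 < gain sa.1 sa.2].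

Definition valid_improvement (I : {set state M * action M}) : Prop :=
  [/\ I != finset.set0, I \subset improvable
    & forall s a b, (s, a) \in I -> (s, b) \in I -> a = b].

(* For a valid [I], at most one action is available to [pick]. *)
Definition improve (I : {set state M * action M}) : policy M :=
  [ffun s => odflt (pi s) [pick a | (s, a) \in I]].

Definition max_gain (I : {set state M * action M}) : Prop :=
  forall s a, (s, a) \in I -> forall b, gain s b <= gain s a.

Lemma discounted_eq0 (U : state M -> R) :
  (forall s, U s = discount M * \sum_(s' : state M) trans s (pi s) s' * U s') ->
  forall s, U s = 0.
Proof.
move=> eqU s0.
have /andP[g0 g1] := discount_itv M.
pose m := [arg max_(i > s0) `|U i|]%O.
have mP s : `|U s| <= `|U m|.
  by rewrite /m; case: Order.TotalTheory.arg_maxP => // i _; apply.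
have le_m : `|U m| <= discount M * `|U m|.
  rewrite {1}eqU normrM (ger0_norm g0) ler_wpM2l //.
  apply: le_trans (ler_norm_sum _ _ _) _.
  rewrite -[leRHS]mul1r -(trans_sum m (pi m)) mulr_suml ler_sum // => s _.
  have /andP[t0 _] := trans_itv m (pi m) s.
  by rewrite normrM (ger0_norm t0) ler_wpM2l.
have m0 : `|U m| <= 0.
  rewrite leNgt; apply/negP => Um.
  by move: le_m; rewrite leNgt gtr_pMl // g1.
by apply/eqP; rewrite -normr_le0 (le_trans (mP s0)).
Qed.

Lemma bellman_unique V W : bellman V -> bellman W -> V = W.
Proof.
move=> bV bW; apply/ffunP => s; apply/eqP; rewrite -subr_eq0; apply/eqP.
apply: (@discounted_eq0 (fun s => V s - W s)) => {}s.
rewrite bV bW opprD addrACA subrr add0r -mulrBr -sumrB; congr (_ * _).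
by apply: eq_bigr => s' _; rewrite mulrBr.
Qed.

Lemma bellman_exists : exists V, bellman V.
Proof.
pose n := #|state M|.
pose P : 'M[R]_n :=
  \matrix_(i, j) trans (enum_val i) (pi (enum_val i)) (enum_val j).
pose B := 1%:M - discount M *: P.
pose r : 'cV[R]_n := \col_i reward (enum_val i) (pi (enum_val i)).
have PE (v : 'cV[R]_n) s : (P *m v) (enum_rank s) 0 =
    \sum_(s' : state M) trans s (pi s) s' * v (enum_rank s') 0.
  rewrite mxE (reindex enum_rank) /=; last exact: onW_bij (@enum_rank_bij _).
  by apply: eq_bigr => s' _; rewrite mxE !enum_rankK.
have uB : B \in unitmx.
  rewrite -unitmx_tr -row_free_unit; apply: inj_row_free => w wB.
  have : B *m w^T = 0 by rewrite -[LHS]trmxK trmx_mul trmxK wB trmx0.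
  rewrite mulmxBl mul1mx -scalemxAl => /eqP; rewrite subr_eq0 => /eqP w_eq.
  apply: trmx_inj; apply/matrixP => i j; rewrite ord1 trmx0 [RHS]mxE.
  rewrite -[i]enum_valK.
  apply: (@discounted_eq0 (fun s => w^T (enum_rank s) 0)) => s.
  by rewrite {1}w_eq mxE PE.
pose v := invmx B *m r.
have Bv : v = r + discount M *: (P *m v).
  apply/eqP; rewrite -subr_eq scalemxAl -{1}[v]mul1mx -mulmxBl.
  by rewrite mulKVmx.
exists [ffun s => v (enum_rank s) 0] => s.
rewrite ffunE {1}Bv !mxE enum_rankK; congr (_ + _ * _).
move: (PE v s); rewrite mxE => ->.
by apply: eq_bigr => s' _; rewrite ffunE.
Qed.

Lemma value_bellman : bellman value.
Proof. by have [V bV] := bellman_exists; apply: (xgetPex _ (ex_intro _ V bV)). Qed.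

End Values.

(* A PI algorithm chooses, on every MDP, a valid improvement set from the list
   [h] of policies visited so far and the current policy [pi]; nothing is
   required once [pi] has no improvable pair, since the run then stops. *)
Record pi_algorithm (R : realType) := PIAlgorithm {
  choose_set : forall M : mdp R,
    seq (policy M) -> policy M -> {set state M * action M};
  choose_set_valid : forall (M : mdp R) (h : seq (policy M)) (pi : policy M),
    improvable pi != finset.set0 -> valid_improvement pi (choose_set h pi)
}.

Definition max_gain_selection (R : realType) (L : pi_algorithm R) : Prop :=
  forall (M : mdp R) (h : seq (policy M)) (pi : policy M),
    improvable pi != finset.set0 -> max_gain pi (choose_set L h pi).

(* [execution L h pi r]: having visited [h] before reaching [pi], [L] visits
   from then on exactly the sequence [r] (which begins with [pi]) and stops. *)
Inductive execution (R : realType) (M : mdp R) (L : pi_algorithm R) :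
    seq (policy M) -> policy M -> seq (policy M) -> Prop :=
| execution_stop h pi :
    improvable pi = finset.set0 -> execution L h pi [:: pi]
| execution_step h pi r :
    improvable pi != finset.set0 ->
    execution L (rcons h pi) (improve pi (choose_set L h pi)) r ->
    execution L h pi (pi :: r).

(* Main.v *)
Require Import Defs.
From mathcomp Require Import all_boot all_order all_algebra.
From mathcomp Require Import reals.
From mathcomp Require Import ring lra zify.

Set Implicit Arguments.
Unset Strict Implicit.
Unset Printing Implicit Defensive.

Import Order.TTheory GRing.Theory Num.Theory.

(** Let the discount be 1/4 and let an action with parameter [t] in [0, 1] have
    reward - t^2 / 8 and move to the other state with probability [t].  If the
    other state is worth [d] more than the present one, the quality of this
    action is, up to a term independent of [t], - (d - t)^2 / 8: the
    max-gain action is the one whose parameter is nearest to [d].  Under a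
    policy with parameters [t] and [u], the gap [d] seen from the state with
    parameter [t] equals (t^2 - u^2) / (2 (3 + t + u)).  Define [x_(n+2)] to be
    this gap for [t = x_n], [u = x_(n+1)], and give the even terms to one state
    and the odd terms to the other.  From the policy with parameters [x_n],
    [x_(n+1)], the max-gain switch at the state using [x_n] leads to [x_(n+2)];
    as [x] decreases strictly, alternating between the two states climbs
    through all the actions one at a time. *)

Local Open Scope ring_scope.

Definition gap_step (R : realType) (p : R * R) : R * R :=
  (p.2, (p.1 ^+ 2 - p.2 ^+ 2) / (2 * (3 + p.1 + p.2))).

(** The iteration carries two consecutive terms; the seeds 1 and 1/2 meet the invariants propagated
    in [gap_seq_bounds]. *)
Definition gap_seq (R : realType) (n : nat) : R :=
  (iter n (@gap_step R) (1, 1 / 2)).1.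

Lemma gap_seqSS (R : realType) (n : nat) :
  gap_seq R n.+2 = (gap_seq R n ^+ 2 - gap_seq R n.+1 ^+ 2)
                   / (2 * (3 + gap_seq R n + gap_seq R n.+1)).
Proof. by []. Qed.

(* The last bound keeps the decay from being too fast, so that the next term is
   again at most half of the present one. *)
Lemma gap_seq_bounds (R : realType) (n : nat) :
  [/\ 0 < gap_seq R n.+1, gap_seq R n <= 1,
      gap_seq R n.+1 <= gap_seq R n / 2
    & gap_seq R n ^+ 2 <= 3 * gap_seq R n.+1].
Proof.
elim: n => [|n].
  by rewrite /gap_seq /=; split; lra.
rewrite gap_seqSS; move: (gap_seq R n) (gap_seq R n.+1) => x y [y0 x1 yx xy].
have d0 : 0 < 2 * (3 + x + y) by lra.
split.
- by apply: divr_gt0 => //; nra.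
- by lra.
- by rewrite ler_pdivrMr //; nra.
(* As 3 + x + y is at most 9/2, it suffices that 12 y^2 <= 3 x^2, which is the halving bound. *)
- by rewrite mulrA ler_pdivlMr //; nra.
Qed.

Lemma gap_seq_gt0 (R : realType) (n : nat) : 0 < gap_seq R n.
Proof. by have [y0 _ yx _] := gap_seq_bounds R n; lra. Qed.

Lemma gap_seq_le1 (R : realType) (n : nat) : gap_seq R n <= 1.
Proof. by case: (gap_seq_bounds R n). Qed.

Lemma gap_seq_le (R : realType) (m n : nat) :
  (gap_seq R m <= gap_seq R n) = (n <= m)%N.
Proof.
apply: (@Order.TotalTheory.le_nmono _ _ nat R (gap_seq R)) => {}n {}m.
rewrite ltEnat /=; elim: n => // n IH.
have ltS : gap_seq R n.+1 < gap_seq R n.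
  by have [y0 _ yx _] := gap_seq_bounds R n; lra.
by rewrite ltnS leq_eqVlt => /predU1P[-> //|/IH]; exact: lt_trans.
Qed.

Definition switch_prob (R : realType) (k : nat) (s : bool) (a : 'I_k) : R :=
  gap_seq R (a.*2 + s).

Definition ladder_trans (R : realType) (k : nat) (s : bool) (a : 'I_k)
    (s' : bool) : R :=
  if s' == s then 1 - switch_prob R s a else switch_prob R s a.

Lemma ladder_trans_itv (R : realType) (k : nat) (s : bool) (a : 'I_k) s' :
  0 <= ladder_trans R s a s' <= 1.
Proof.
rewrite /ladder_trans /switch_prob.
have := gap_seq_gt0 R (a.*2 + s); have := gap_seq_le1 R (a.*2 + s).
by case: ifP => _; lra.
Qed.

Lemma ladder_trans_sum (R : realType) (k : nat) (s : bool) (a : 'I_k) :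
  \sum_(s' : bool) ladder_trans R s a s' = 1.
Proof. by rewrite big_bool /ladder_trans; case: s => /=; ring. Qed.

Lemma quarter_itv (R : realType) : 0 <= (1 / 4 : R) < 1.
Proof. lra. Qed.

Definition ladder (R : realType) (k : nat) : mdp R :=
  @MDP R bool 'I_k (@ladder_trans R k) (fun s a => - (switch_prob R s a ^+ 2 / 8))
    (1 / 4) (@ladder_trans_itv R k) (@ladder_trans_sum R k) (quarter_itv R).

Definition value_gap (R : realType) (k : nat) (pi : policy (ladder R k))
  (s : bool) : R := value pi (~~ s) - value pi s.

(** Four times the Bellman equation, with the value at [s] itself moved to the left. *)
Lemma ladder_value (R : realType) (k : nat) (pi : policy (ladder R k)) (s : bool) :
  3 * value pi s
  = switch_prob R s (pi s) * value_gap pi s - switch_prob R s (pi s) ^+ 2 / 2.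
Proof.
have := value_bellman pi s; rewrite /value_gap /= big_bool /ladder_trans.
by case: s => /=; lra.
Qed.

(** The gaps seen from the two states are opposite, so subtracting the two instances of
    [ladder_value] leaves a linear equation for the gap, with coefficient 3 + t + u. *)
Lemma ladder_value_gap (R : realType) (k : nat) (pi : policy (ladder R k)) s
    (t := switch_prob R s (pi s)) (u := switch_prob R (~~ s) (pi (~~ s))) :
  value_gap pi s = (t ^+ 2 - u ^+ 2) / (2 * (3 + t + u)).
Proof.
have t0 : 0 < t by exact: gap_seq_gt0.
have u0 : 0 < u by exact: gap_seq_gt0.
have := ladder_value pi s; have := ladder_value pi (~~ s).
rewrite -/t -/u /value_gap negbK.
set v := value pi s; set w := value pi (~~ s) => eqw eqv.
have d0 : 2 * (3 + t + u) != 0 by rewrite lt0r_neq0 //; lra.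
apply: (canRL (mulfK d0)); lra.
Qed.

(** Complete the square in the parameter; the current action has gain 0, which fixes the remaining
    term. *)
Lemma ladder_gain (R : realType) (k : nat) (pi : policy (ladder R k)) s a :
  gain pi s a = ((value_gap pi s - switch_prob R s (pi s)) ^+ 2
                 - (value_gap pi s - switch_prob R s a) ^+ 2) / 8.
Proof.
have := ladder_value pi s.
rewrite /gain /qvalue /= big_bool /ladder_trans /value_gap.
by case: s a => /= a; lra.
Qed.

(* Reversing the order of preference at every step makes two states take
   turns. *)
Definition alternating_choice (R : realType) (M : mdp R) (h : seq (policy M))
    (pi : policy M) : {set state M * action M} :=
  if [seq s <- rot (~~ odd (size h)) (enum (state M))
        | [exists a, (s, a) \in improvable pi]] is s :: _
  then [set (s, [arg max_(a > pi s) gain pi s a]%O)] else finset.set0.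

Lemma alternating_choiceP (R : realType) (M : mdp R) (h : seq (policy M))
    (pi : policy M) :
  improvable pi != finset.set0 ->
  valid_improvement pi (alternating_choice h pi)
  /\ max_gain pi (alternating_choice h pi).
Proof.
case/set0Pn => -[s0 a0] imp0; rewrite /alternating_choice.
set l := filter _ _; have : all (fun s => [exists a, (s, a) \in improvable pi]) l.
  exact: filter_all.
have : s0 \in l.
  by rewrite mem_filter mem_rot mem_enum andbT; apply/existsP; exists a0.
case: l => // s l _ /= /andP[/existsP[a imp_a] _].
case: Order.TotalTheory.arg_maxP => // b _ b_max; split.
  split.
  - by apply/set0Pn; exists (s, b); rewrite inE.
  - rewrite sub1set inE /=; apply: lt_le_trans (b_max a isT).
    by move: imp_a; rewrite inE.
  - by move=> s1 a1 a2; rewrite !inE => /eqP[_ ->] /eqP[_ ->].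
by move=> s1 a1; rewrite inE => /eqP[-> ->] c; exact: b_max.
Qed.

Definition alternating_pi (R : realType) : pi_algorithm R :=
  PIAlgorithm (fun M h pi imp => proj1 (@alternating_choiceP R M h pi imp)).

(* The parameters are [x_n] at the state [odd n] and [x_(n+1)] at the other,
   provided [n <= k.*2]: beyond that, [inord] returns [ord0]. *)
Definition rung (R : realType) (k n : nat) : policy (ladder R k.+1) :=
  [ffun s : bool => inord (if s == odd n then n./2 else uphalf n)].

(** Recovering the index from the policy shows that the rungs are pairwise distinct. *)
Lemma rung_sum (R : realType) (k n : nat) :
  (n <= k.*2)%N -> (rung R k n false + rung R k n true)%N = n.
Proof. by move=> nk; rewrite !ffunE !inordK; case: (boolP (odd n)) => /=; lia. Qed.

Lemma switch_prob_rung (R : realType) (k n : nat) : (n <= k.*2)%N ->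
  switch_prob R (odd n) (rung R k n (odd n)) = gap_seq R n
  /\ switch_prob R (~~ odd n) (rung R k n (~~ odd n)) = gap_seq R n.+1.
Proof.
move=> nk; rewrite /switch_prob !ffunE eqxx; case: (boolP (odd n)) => /= on;
  by split; congr gap_seq; rewrite inordK; lia.
Qed.

Lemma value_gap_rung (R : realType) (k n : nat) : (n <= k.*2)%N ->
  value_gap (rung R k n) (odd n) = gap_seq R n.+2.
Proof.
move=> nk; have [t_eq u_eq] := switch_prob_rung R nk.
by rewrite ladder_value_gap t_eq u_eq -gap_seqSS.
Qed.

Lemma gain_rung (R : realType) (k n : nat) (a : 'I_k.+1) : (n <= k.*2)%N ->
  gain (rung R k n) (odd n) a
  = ((gap_seq R n.+2 - gap_seq R n) ^+ 2
     - (gap_seq R n.+2 - switch_prob R (odd n) a) ^+ 2) / 8.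
Proof.
move=> nk; have [t_eq _] := switch_prob_rung R nk.
by rewrite ladder_gain value_gap_rung // t_eq.
Qed.

Lemma switch_prob_next (R : realType) (k n : nat) (a : 'I_k) :
  switch_prob R (odd n) a = gap_seq R n.+2 -> a = n./2.+1 :> nat.
Proof.
move=> eq_p; have eq_n : a.*2 + odd n = n.+2.
  by apply/eqP; rewrite eqn_leq -!(gap_seq_le R) -eq_p lexx.
by lia.
Qed.

Lemma switch_prob_inord (R : realType) (k n : nat) : (n < k.*2)%N ->
  switch_prob R (odd n) (inord n./2.+1 : 'I_k.+1) = gap_seq R n.+2.
Proof.
by move=> nk; rewrite /switch_prob inordK; [congr gap_seq|]; lia.
Qed.

Lemma gain_rung_next (R : realType) (k n : nat) : (n < k.*2)%N ->
  0 < gain (rung R k n) (odd n) (inord n./2.+1).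
Proof.
move=> nk; rewrite gain_rung 1?ltnW // switch_prob_inord //.
have lt_x : gap_seq R n.+2 < gap_seq R n by rewrite ltNge gap_seq_le; lia.
by nra.
Qed.

Lemma improve_rung (R : realType) (k n : nat) (h : seq (policy (ladder R k.+1))) :
  (n < k.*2)%N -> size h = n ->
  improve (rung R k n) (alternating_choice h (rung R k n)) = rung R k n.+1.
Proof.
move=> nk hn; rewrite /alternating_choice hn.
(* With a history of length [n], the state whose parameter is x_n is tried first. *)
have -> : rot (~~ odd n) (enum (state (ladder R k.+1))) = [:: odd n; ~~ odd n].
  by rewrite enumT unlock /=; case: (odd n).
have imp : [exists a, (odd n, a) \in improvable (rung R k n)].
  by apply/existsP; exists (inord n./2.+1); rewrite inE gain_rung_next.
rewrite /= imp; case: Order.TotalTheory.arg_maxP => // b _ b_max.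
(* The parameter of action [n./2.+1] equals the gap, so its square term vanishes; that of any
   maximiser must vanish too, and the parameters at one state are distinct. *)
have b_eq : b = n./2.+1 :> nat.
  apply: (@switch_prob_next R).
  have := b_max (inord n./2.+1) isT; rewrite /= !gain_rung 1?ltnW //.
  rewrite switch_prob_inord // subrr => b_best.
  apply/esym/eqP; rewrite -subr_eq0 -sqrf_eq0 eq_le sqr_ge0 andbT; lra.
apply/ffunP => s; rewrite !ffunE; apply: val_inj.
case: pickP => [c|no_c] /=.
  rewrite inE => /eqP[-> ->]; rewrite b_eq inordK; case: ifP; lia.
have s_eq : s = ~~ odd n.
  have := no_c b; rewrite inE xpair_eqE eqxx andbT.
  by case: s {no_c}; case: (odd n).
by rewrite s_eq; case: (odd n).
Qed.

(** Each state already uses its smallest parameter, and the gap lies below it: x_(2k+2) at [false],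
    the negative of that at [true]. No other parameter is nearer. *)
Lemma rung_optimal (R : realType) (k : nat) : improvable (rung R k k.*2) = finset.set0.
Proof.
apply/setP => -[s a]; rewrite !inE /=; apply/negbTE; rewrite -leNgt.
have odd_n : odd k.*2 = false by rewrite odd_double.
have := value_gap_rung R (leqnn k.*2); have := switch_prob_rung R (leqnn k.*2).
rewrite odd_n /= => -[t_eq u_eq] gap_eq.
have x0 := gap_seq_gt0 R k.*2.+2.
have ak : (a <= k)%N by rewrite -ltnS ltn_ord.
case: s a ak => a ak /=; rewrite ladder_gain.
- have -> : value_gap (rung R k k.*2) true = - gap_seq R k.*2.+2.
    by rewrite -gap_eq /value_gap opprB.
  have : gap_seq R k.*2.+1 <= switch_prob R true a by rewrite gap_seq_le; lia.
  by rewrite u_eq; have := gap_seq_gt0 R k.*2.+1; nra.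
- have : gap_seq R k.*2 <= switch_prob R false a by rewrite gap_seq_le; lia.
  have : gap_seq R k.*2.+2 <= gap_seq R k.*2 by rewrite gap_seq_le; lia.
  by rewrite gap_eq t_eq; nra.
Qed.

Lemma ladder_execution (R : realType) (k m n : nat)
    (h : seq (policy (ladder R k.+1))) :
  (n + m)%N = k.*2 -> size h = n ->
  execution (alternating_pi R) h (rung R k n) [seq rung R k i | i <- iota n m.+1].
Proof.
elim: m n h => [|m IH] n h nm hn.
  by move: nm; rewrite addn0 => ->; apply: execution_stop; exact: rung_optimal.
have nk : (n < k.*2)%N by lia.
apply: execution_step.
  apply/set0Pn; exists (odd n, inord n./2.+1); rewrite inE; exact: gain_rung_next.
rewrite [choose_set _ _ _]/= improve_rung //; apply: IH; first by lia.
by rewrite size_rcons hn.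
Qed.

Theorem proposition4 (R : realType) (k : nat) (hk : (2 <= k)%N) :
  exists (M : mdp R) (pi0 : policy M) (L : pi_algorithm R),
    [/\ #|state M| = 2%N,
        #|action M| = k,
        max_gain_selection L
      & exists2 visited : seq (policy M),
          execution L [::] pi0 visited
        & (2 * k - 1 <= size (undup visited))%N].
Proof.
case: k hk => // k _.
exists (ladder R k.+1), (rung R k 0), (alternating_pi R); split.
- exact: card_bool.
- exact: card_ord.
- by move=> M h pi imp; exact: (proj2 (alternating_choiceP h imp)).
exists [seq rung R k i | i <- iota 0 k.*2.+1]; first exact: ladder_execution.
(* Here [k] is one less than the number of actions, so the 2k + 1 distinct rungs are the required
   2(k + 1) - 1 policies. *)
rewrite undup_id ?size_map ?size_iota; first by lia.
rewrite map_inj_in_uniq ?iota_uniq // => m n; rewrite !mem_iota => mk nk eq_r.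
by rewrite -(@rung_sum R k m) ?eq_r ?rung_sum //; lia.
Qed.
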